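(* Let $\mathbf{C}$ be a small symmetric strict monoidal category. Then the symmetric strict monoidal category $\overline{\mathbf{Prop}(\mathbf{C})}$ is monoidally equivalent to $\mathbf{C}$.
   Context: An SMC is a small symmetric monoidal category; an SSMC (symmetric strict monoidal category) is an SMC whose associators and unitors are all identities. A prop $\mathbf{P}$ is an SSMC such that the monoid structure induced by $\otimes$ on its set of objects is free over a set $C(\mathbf{P})$ of objects, called colours; its objects are thus finite lists of colours, with concatenation written $+$ as tensor product and the empty list $0$ as tensor unit. If $\mathbf{P}$ is a prop, $\overline{\mathbf{P}}$ denotes $\mathbf{P}$ regarded as an SSMC. Let $\mathbf{C}$ be an SSMC with set of objects $O(\mathbf{C})$ and unit $I$, and let $O(\mathbf{C})^*$ be the set of finite lists of elements of $O(\mathbf{C})$; the one-element list is written $[c]$. The content $\{\mathbf{\ell}\}\in O(\mathbf{C})$ of a list $\mathbf{\ell}\in O(\mathbf{C})^*$ is defined by $\{0\}=I$, $\{[c]\}=c$ and $\{\mathbf{a}+\mathbf{b}\}=\{\mathbf{a}\}\otimes\{\mathbf{b}\}$. The prop $\mathbf{Prop}(\mathbf{C})$ is the prop whose set of colours is $O(\mathbf{C})$ (so its objects are the lists in $O(\mathbf{C})^*$) and with $\mathbf{Prop}(\mathbf{C})[\mathbf{a},\mathbf{b}]=\mathbf{C}[\{\mathbf{a}\},\{\mathbf{b}\}]$. Identities, sequential composition, tensor product of arrows and swap maps are those of $\mathbf{C}$ (e.g. the swap $\mathbf{a}+\mathbf{b}\to\mathbf{b}+\mathbf{a}$ is the arrow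 $\sigma_{\{\mathbf{a}\},\{\mathbf{b}\}}$ of $\mathbf{C}$). A strong symmetric monoidal (SM) functor $F:\mathbf{C}\to\mathbf{D}$ between SMCs is a functor with a natural isomorphism $\phi_{a,b}:F(a\otimes b)\to F(a)\otimes F(b)$ and an isomorphism $\phi:F(I)\to I$ satisfying the usual coherence conditions with associators, unitors and swaps. A natural transformation $\beta:F\Rightarrow G$ between SM functors is monoidal if $\phi^G_{a,b}\circ\beta_{a\otimes b}=(\beta_a\otimes\beta_b)\circ\phi^F_{a,b}$ and $\phi^G\circ\beta_I=\phi^F$. Two SMCs $\mathbf{C},\mathbf{D}$ are monoidally equivalent if there are SM functors $F:\mathbf{C}\to\mathbf{D}$ and $G:\mathbf{D}\to\mathbf{C}$ forming an equivalence of categories whose natural isomorphisms $FG\Rightarrow id_{\mathbf{D}}$ and $GF\Rightarrow id_{\mathbf{C}}$ are monoidal. *)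

(* Defs.v *)
(* Sets of objects are types; equality of objects is Leibniz equality, with
   uniqueness of identity proofs. *)
From Stdlib Require Import List Eqdep.
Import ListNotations.

Set Implicit Arguments.
Unset Strict Implicit.
Unset Printing Implicit Defensive.

Declare Scope cat_scope.
Delimit Scope cat_scope with cat.
Reserved Notation "g ∘ f" (at level 40, left associativity).
Reserved Notation "a ⊗ b" (at level 34, right associativity).
Reserved Notation "f ⊗₁ g" (at level 34, right associativity).
Local Open Scope cat_scope.

Record Category := {
  Ob : Type;
  Hom : Ob -> Ob -> Type;
  idn : forall a, Hom a a;
  comp : forall a b c, Hom b c -> Hom a b -> Hom a c;
  comp_id_l : forall a b (f : Hom a b), comp (idn b) f = f;
  comp_id_r : forall a b (f : Hom a b), comp f (idn a) = f;
  comp_assoc : forall a b c d (h : Hom c d) (g : Hom b c) (f : Hom a b),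
    comp h (comp g f) = comp (comp h g) f
}.
Arguments Hom {_} a b : rename.
Arguments idn {_} a : rename.
Notation "g ∘ f" := (comp g f) : cat_scope.

Definition is_iso (C : Category) (a b : Ob C) (f : Hom a b) : Prop :=
  exists g : Hom b a, g ∘ f = idn a /\ f ∘ g = idn b.

Inductive is_identity (C : Category) : forall a b : Ob C, Hom a b -> Prop :=
| is_identity_idn : forall a, is_identity (idn a).

(* The identity arrow, typed along an equality between its two endpoints. *)
Definition eq_hom (C : Category) (a b : Ob C) (e : a = b) : Hom a b :=
  match e in _ = x return Hom a x with eq_refl => idn a end.

Record SMC := {
  smc_cat :> Category;
  tensor : Ob smc_cat -> Ob smc_cat -> Ob smc_cat;
  tensor_hom : forall a b a' b' : Ob smc_cat,
    Hom a a' -> Hom b b' -> Hom (tensor a b) (tensor a' b');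
  munit : Ob smc_cat;
  assoc : forall a b c, Hom (tensor (tensor a b) c) (tensor a (tensor b c));
  lunit : forall a, Hom (tensor munit a) a;
  runit : forall a, Hom (tensor a munit) a;
  swap : forall a b, Hom (tensor a b) (tensor b a);
  tensor_id : forall a b, tensor_hom (idn a) (idn b) = idn (tensor a b);
  tensor_comp : forall a b a' b' a'' b''
      (f' : Hom a' a'') (f : Hom a a') (g' : Hom b' b'') (g : Hom b b'),
    tensor_hom (f' ∘ f) (g' ∘ g) = tensor_hom f' g' ∘ tensor_hom f g;
  assoc_iso : forall a b c, is_iso (assoc a b c);
  lunit_iso : forall a, is_iso (lunit a);
  runit_iso : forall a, is_iso (runit a);
  assoc_nat : forall a b c a' b' c' (f : Hom a a') (g : Hom b b') (h : Hom c c'),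
    assoc a' b' c' ∘ tensor_hom (tensor_hom f g) h
    = tensor_hom f (tensor_hom g h) ∘ assoc a b c;
  lunit_nat : forall a a' (f : Hom a a'),
    lunit a' ∘ tensor_hom (idn munit) f = f ∘ lunit a;
  runit_nat : forall a a' (f : Hom a a'),
    runit a' ∘ tensor_hom f (idn munit) = f ∘ runit a;
  swap_nat : forall a b a' b' (f : Hom a a') (g : Hom b b'),
    swap a' b' ∘ tensor_hom f g = tensor_hom g f ∘ swap a b;
  pentagon : forall a b c d,
    assoc a b (tensor c d) ∘ assoc (tensor a b) c d
    = tensor_hom (idn a) (assoc b c d) ∘ assoc a (tensor b c) d
      ∘ tensor_hom (assoc a b c) (idn d);
  triangle : forall a b,
    tensor_hom (idn a) (lunit b) ∘ assoc a munit b
    = tensor_hom (runit a) (idn b);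
  swap_swap : forall a b, swap b a ∘ swap a b = idn (tensor a b);
  hexagon : forall a b c,
    assoc b c a ∘ swap a (tensor b c) ∘ assoc a b c
    = tensor_hom (idn b) (swap a c) ∘ assoc b a c
      ∘ tensor_hom (swap a b) (idn c)
}.
Arguments tensor {s} a b.
Arguments tensor_hom {s a b a' b'} f g.
Arguments munit {s}.
Arguments assoc {s} a b c.
Arguments lunit {s} a.
Arguments runit {s} a.
Arguments swap {s} a b.
Notation "a ⊗ b" := (tensor a b) : cat_scope.
Notation "f ⊗₁ g" := (tensor_hom f g) : cat_scope.

(* [is_identity (assoc a b c)] forces its source and target to coincide, so
   the objects of a strict category form a monoid. *)
Definition is_strict (C : SMC) : Prop :=
  (forall a b c : Ob C, is_identity (assoc a b c)) /\
  (forall a : Ob C, is_identity (lunit a)) /\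
  (forall a : Ob C, is_identity (runit a)).

Record SSMC := {
  ssmc_smc :> SMC;
  ssmc_strict : is_strict ssmc_smc
}.

Definition content (C : SMC) (l : list (Ob C)) : Ob C :=
  fold_right tensor munit l.

(* Freeness of the monoid of objects over the colours: every object is the
   tensor product of a unique finite list of colours. *)
Record prop := {
  prop_ssmc : SSMC;
  colour : Type;
  colour_ob : colour -> Ob prop_ssmc;
  prop_free : forall x : Ob prop_ssmc,
    exists! w : list colour, content (map colour_ob w) = x
}.

Record Functor (C D : Category) := {
  fob :> Ob C -> Ob D;
  fhom : forall a b, Hom a b -> Hom (fob a) (fob b);
  fhom_id : forall a, fhom (idn a) = idn (fob a);
  fhom_comp : forall a b c (g : Hom b c) (f : Hom a b),
    fhom (g ∘ f) = fhom g ∘ fhom f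
}.
Arguments fhom {C D} f {a b} _ : rename.

Record SMFunctor (C D : SMC) := {
  smf_functor :> Functor C D;
  phi : forall a b : Ob C,
    Hom (smf_functor (a ⊗ b)) (smf_functor a ⊗ smf_functor b);
  phi_unit : Hom (smf_functor munit) munit;
  phi_iso : forall a b, is_iso (phi a b);
  phi_unit_iso : is_iso phi_unit;
  phi_nat : forall (a b a' b' : Ob C) (f : Hom a a') (g : Hom b b'),
    phi a' b' ∘ fhom smf_functor (f ⊗₁ g)
    = (fhom smf_functor f ⊗₁ fhom smf_functor g) ∘ phi a b;
  phi_assoc : forall a b c : Ob C,
    assoc (smf_functor a) (smf_functor b) (smf_functor c)
      ∘ (phi a b ⊗₁ idn (smf_functor c)) ∘ phi (a ⊗ b) c
    = (idn (smf_functor a) ⊗₁ phi b c) ∘ phi a (b ⊗ c)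
      ∘ fhom smf_functor (assoc a b c);
  phi_lunit : forall a : Ob C,
    lunit (smf_functor a) ∘ (phi_unit ⊗₁ idn (smf_functor a)) ∘ phi munit a
    = fhom smf_functor (lunit a);
  phi_runit : forall a : Ob C,
    runit (smf_functor a) ∘ (idn (smf_functor a) ⊗₁ phi_unit) ∘ phi a munit
    = fhom smf_functor (runit a);
  phi_swap : forall a b : Ob C,
    swap (smf_functor a) (smf_functor b) ∘ phi a b
    = phi b a ∘ fhom smf_functor (swap a b)
}.
Arguments phi {C D} s a b.
Arguments phi_unit {C D} s.

Record NatTrans (C D : Category) (F G : Functor C D) := {
  component :> forall a : Ob C, Hom (F a) (G a);
  naturality : forall (a b : Ob C) (f : Hom a b),
    component b ∘ fhom F f = fhom G f ∘ component a
}.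

Definition is_nat_iso (C D : Category) (F G : Functor C D)
    (beta : NatTrans F G) : Prop :=
  forall a : Ob C, is_iso (beta a).

Definition is_monoidal (C D : SMC) (F G : SMFunctor C D)
    (beta : NatTrans F G) : Prop :=
  (forall a b : Ob C, phi G a b ∘ beta (a ⊗ b) = (beta a ⊗₁ beta b) ∘ phi F a b)
  /\ phi_unit G ∘ beta munit = phi_unit F.

Lemma is_iso_idn (C : Category) (a : Ob C) : is_iso (idn a).
Proof. exists (idn a). split; apply comp_id_l. Qed.

Lemma is_iso_comp (C : Category) (a b c : Ob C) (g : Hom b c) (f : Hom a b) :
  is_iso g -> is_iso f -> is_iso (g ∘ f).
Proof.
  intros [g' [Hg1 Hg2]] [f' [Hf1 Hf2]].
  exists (f' ∘ g'). split.
  - now rewrite comp_assoc, <- (comp_assoc f' g' g), Hg1, comp_id_r.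
  - now rewrite comp_assoc, <- (comp_assoc g f f'), Hf2, comp_id_r.
Qed.

Lemma is_iso_fhom (C D : Category) (F : Functor C D) (a b : Ob C) (f : Hom a b) :
  is_iso f -> is_iso (fhom F f).
Proof.
  intros [g [H1 H2]]. exists (fhom F g).
  now rewrite <- !fhom_comp, H1, H2, !fhom_id.
Qed.

Definition id_functor (C : Category) : Functor C C :=
  {| fob := fun a => a;
     fhom := fun a b f => f;
     fhom_id := fun a => eq_refl;
     fhom_comp := fun a b c g f => eq_refl |}.

Definition comp_functor (C D E : Category) (G : Functor D E) (F : Functor C D) :
  Functor C E.
Proof.
  refine {| fob := fun a => G (F a);
            fhom := fun a b f => fhom G (fhom F f) |}.
  - intros. now rewrite !fhom_id.
  - intros. now rewrite !fhom_comp.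
Defined.

Definition id_smf (C : SMC) : SMFunctor C C.
Proof.
  refine {| smf_functor := id_functor C;
            phi := fun a b => idn (a ⊗ b);
            phi_unit := idn munit |}; simpl; intros;
    rewrite ?tensor_id, ?comp_id_r, ?comp_id_l;
    auto using is_iso_idn.
Defined.

Lemma tensor_comp_l (C : SMC) (a a' a'' b : Ob C) (f' : Hom a' a'') (f : Hom a a') :
  (f' ∘ f) ⊗₁ idn b = (f' ⊗₁ idn b) ∘ (f ⊗₁ idn b).
Proof. now rewrite <- tensor_comp, comp_id_l. Qed.

Lemma tensor_comp_r (C : SMC) (a a' a'' b : Ob C) (f' : Hom a' a'') (f : Hom a a') :
  idn b ⊗₁ (f' ∘ f) = (idn b ⊗₁ f') ∘ (idn b ⊗₁ f).
Proof. now rewrite <- tensor_comp, comp_id_l. Qed.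

Definition comp_smf (C D E : SMC) (G : SMFunctor D E) (F : SMFunctor C D) :
  SMFunctor C E.
Proof.
  refine {| smf_functor := comp_functor G F;
            phi := fun a b => phi G (F a) (F b) ∘ fhom G (phi F a b);
            phi_unit := phi_unit G ∘ fhom G (phi_unit F) |}; simpl.
  - intros. apply is_iso_comp; [apply phi_iso | apply is_iso_fhom, phi_iso].
  - apply is_iso_comp; [apply phi_unit_iso | apply is_iso_fhom, phi_unit_iso].
  - intros.
    rewrite <- comp_assoc, <- fhom_comp, phi_nat, fhom_comp, comp_assoc, phi_nat.
    now rewrite !comp_assoc.
  - intros a b c.
    rewrite tensor_comp_l, tensor_comp_r, !comp_assoc.
    rewrite <- (comp_assoc _ (fhom G (phi F a b) ⊗₁ _)).
    rewrite <- (fhom_id G (F c)), <- phi_nat, !comp_assoc, !fhom_id.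
    rewrite phi_assoc.
    rewrite <- (comp_assoc _ (idn (G (F a)) ⊗₁ fhom G (phi F b c))).
    rewrite <- (fhom_id G (F a)), <- phi_nat, !comp_assoc, !fhom_id.
    rewrite <- !comp_assoc, <- !fhom_comp.
    now rewrite (comp_assoc (assoc (F a) (F b) (F c))), phi_assoc, <- comp_assoc.
  - intros a.
    rewrite tensor_comp_l, !comp_assoc.
    rewrite <- (comp_assoc _ (fhom G (phi_unit F) ⊗₁ _)).
    rewrite <- (fhom_id G (F a)), <- phi_nat, !comp_assoc, !fhom_id.
    rewrite phi_lunit, <- !fhom_comp.
    now rewrite phi_lunit.
  - intros a.
    rewrite tensor_comp_r, !comp_assoc.
    rewrite <- (comp_assoc _ (_ ⊗₁ fhom G (phi_unit F))).
    rewrite <- (fhom_id G (F a)), <- phi_nat, !comp_assoc, !fhom_id.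
    rewrite phi_runit, <- !fhom_comp.
    now rewrite phi_runit.
  - intros a b.
    rewrite comp_assoc, phi_swap, <- !comp_assoc, <- !fhom_comp.
    now rewrite phi_swap.
Defined.

Definition monoidally_equivalent (C D : SMC) : Prop :=
  exists (F : SMFunctor C D) (G : SMFunctor D C)
         (epsilon : NatTrans (comp_smf F G) (id_smf D))
         (eta : NatTrans (comp_smf G F) (id_smf C)),
    (is_nat_iso epsilon /\ is_monoidal epsilon) /\
    (is_nat_iso eta /\ is_monoidal eta).

(* [heq f g]: f and g are the same arrow, with equal but possibly not
   convertible endpoints. *)
Inductive heq (C : Category) (a b : Ob C) (f : Hom a b) :
  forall a' b' : Ob C, Hom a' b' -> Prop :=
| heq_refl : heq f f.

Lemma heq_inv (C : Category) (a b a' b' : Ob C) (f : Hom a b) (g : Hom a' b') :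
  heq f g -> exists (p : a = a') (q : b = b'),
    g = eq_hom q ∘ f ∘ eq_hom (eq_sym p).
Proof.
  intros []. exists eq_refl, eq_refl. simpl.
  now rewrite comp_id_l, comp_id_r.
Qed.

Lemma heq_eq (C : Category) (a b : Ob C) (f g : Hom a b) : heq f g -> f = g.
Proof.
  intros H. destruct (heq_inv H) as (p & q & ->).
  rewrite (UIP_refl _ _ p), (UIP_refl _ _ q). simpl.
  now rewrite comp_id_l, comp_id_r.
Qed.

Lemma eq_heq (C : Category) (a b : Ob C) (f g : Hom a b) : f = g -> heq f g.
Proof. intros ->. constructor. Qed.

Lemma heq_sym (C : Category) (a b a' b' : Ob C) (f : Hom a b) (g : Hom a' b') :
  heq f g -> heq g f.
Proof. intros []. constructor. Qed.

Lemma heq_trans (C : Category) (a b a' b' a'' b'' : Ob C)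
    (f : Hom a b) (g : Hom a' b') (h : Hom a'' b'') :
  heq f g -> heq g h -> heq f h.
Proof. intros [] H. exact H. Qed.

Lemma heq_comp (C : Category) (a b c a' b' c' : Ob C)
    (g : Hom b c) (f : Hom a b) (g' : Hom b' c') (f' : Hom a' b') :
  heq g g' -> heq f f' -> heq (g ∘ f) (g' ∘ f').
Proof.
  intros Hg Hf. pose proof (heq_inv Hf) as (p & q & _).
  pose proof (heq_inv Hg) as (_ & r & _).
  destruct p, q, r.
  rewrite (heq_eq Hg), (heq_eq Hf). constructor.
Qed.

Lemma heq_tensor (C : SMC) (a b c d a' b' c' d' : Ob C)
    (f : Hom a b) (g : Hom c d) (f' : Hom a' b') (g' : Hom c' d') :
  heq f f' -> heq g g' -> heq (f ⊗₁ g) (f' ⊗₁ g').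
Proof. intros [] []. constructor. Qed.

Lemma heq_idn (C : Category) (a b : Ob C) : a = b -> heq (idn a) (idn b).
Proof. intros []. constructor. Qed.

Lemma heq_swap (C : SMC) (a b a' b' : Ob C) :
  a = a' -> b = b' -> heq (swap a b) (swap a' b').
Proof. intros [] []. constructor. Qed.

Lemma heq_eq_hom_l (C : Category) (a b b' : Ob C) (e : b = b') (f : Hom a b) :
  heq (eq_hom e ∘ f) f.
Proof. destruct e. simpl. rewrite comp_id_l. constructor. Qed.

Lemma heq_eq_hom_r (C : Category) (a a' b : Ob C) (e : a = a') (f : Hom a' b) :
  heq (f ∘ eq_hom e) f.
Proof. destruct e. simpl. rewrite comp_id_r. constructor. Qed.

Lemma heq_eq_hom (C : Category) (a b c : Ob C) (e : a = b) :
  b = c -> heq (eq_hom e) (idn c).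
Proof. intros []. destruct e. constructor. Qed.

Lemma is_identity_heq (C : Category) (a b : Ob C) (f : Hom a b) :
  is_identity f -> heq f (idn a).
Proof. intros []. constructor. Qed.

Lemma is_identity_ob (C : Category) (a b : Ob C) (f : Hom a b) :
  is_identity f -> a = b.
Proof. intros []. reflexivity. Qed.

Lemma is_identity_comp (C : Category) (a b c : Ob C) (g : Hom b c) (f : Hom a b) :
  is_identity g -> is_identity f -> is_identity (g ∘ f).
Proof.
  intros Hg Hf. revert a f Hf. destruct Hg. intros a' f Hf.
  rewrite comp_id_l. exact Hf.
Qed.

Lemma is_identity_eq (C : Category) (a b : Ob C) (f g : Hom a b) :
  is_identity f -> is_identity g -> f = g.
Proof.
  intros Hf Hg. apply heq_eq.
  exact (heq_trans (is_identity_heq Hf) (heq_sym (is_identity_heq Hg))).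
Qed.

Lemma is_identity_eq_hom (C : Category) (a b : Ob C) (e : a = b) :
  is_identity (eq_hom e).
Proof. destruct e. constructor. Qed.

Lemma is_identity_iso (C : Category) (a b : Ob C) (f : Hom a b) :
  is_identity f -> is_iso f.
Proof. intros []. apply is_iso_idn. Qed.

Lemma tensor_assoc (C : SSMC) (a b c : Ob C) : (a ⊗ b) ⊗ c = a ⊗ (b ⊗ c).
Proof. exact (is_identity_ob (proj1 (ssmc_strict C) a b c)). Qed.

Lemma tensor_unit_l (C : SSMC) (a : Ob C) : munit ⊗ a = a.
Proof. exact (is_identity_ob (proj1 (proj2 (ssmc_strict C)) a)). Qed.

Lemma tensor_unit_r (C : SSMC) (a : Ob C) : a ⊗ munit = a.
Proof. exact (is_identity_ob (proj2 (proj2 (ssmc_strict C)) a)). Qed.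

Lemma heq_identity_l (C : Category) (a b c : Ob C) (i : Hom b c) (f : Hom a b) :
  is_identity i -> heq (i ∘ f) f.
Proof. intros H. revert f. destruct H. intros f. rewrite comp_id_l. constructor. Qed.

Lemma heq_identity_r (C : Category) (a b c : Ob C) (i : Hom a b) (f : Hom b c) :
  is_identity i -> heq (f ∘ i) f.
Proof. intros H. revert f. destruct H. intros f. rewrite comp_id_r. constructor. Qed.

Lemma heq_tensor_assoc (C : SSMC) (a b c a' b' c' : Ob C)
    (f : Hom a a') (g : Hom b b') (h : Hom c c') :
  heq ((f ⊗₁ g) ⊗₁ h) (f ⊗₁ (g ⊗₁ h)).
Proof.
  destruct (ssmc_strict C) as [H _].
  eapply heq_trans.
  { apply heq_sym, (heq_identity_l _ (H a' b' c')). }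
  rewrite assoc_nat. apply heq_identity_r, H.
Qed.

Lemma heq_tensor_unit_l (C : SSMC) (a a' : Ob C) (f : Hom a a') :
  heq (idn munit ⊗₁ f) f.
Proof.
  destruct (ssmc_strict C) as [_ [H _]].
  eapply heq_trans.
  { apply heq_sym, (heq_identity_l _ (H a')). }
  rewrite lunit_nat. apply heq_identity_r, H.
Qed.

Lemma heq_tensor_unit_r (C : SSMC) (a a' : Ob C) (f : Hom a a') :
  heq (f ⊗₁ idn munit) f.
Proof.
  destruct (ssmc_strict C) as [_ [_ H]].
  eapply heq_trans.
  { apply heq_sym, (heq_identity_l _ (H a')). }
  rewrite runit_nat. apply heq_identity_r, H.
Qed.

Lemma heq_hexagon (C : SSMC) (a b c : Ob C) :
  heq (swap a (b ⊗ c))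
    ((idn b ⊗₁ swap a c) ∘ (eq_hom (tensor_assoc b a c)
      ∘ (swap a b ⊗₁ idn c))).
Proof.
  destruct (ssmc_strict C) as [H _].
  eapply heq_trans.
  { apply heq_sym, (heq_identity_l _ (H b c a)). }
  eapply heq_trans.
  { apply heq_sym, (heq_identity_r _ (H a b c)). }
  rewrite hexagon, comp_assoc.
  rewrite (is_identity_eq (H b a c) (is_identity_eq_hom (tensor_assoc b a c))).
  constructor.
Qed.

Lemma content_nil (C : SSMC) : content (@nil (Ob C)) = munit.
Proof. reflexivity. Qed.

Lemma content_single (C : SSMC) (c : Ob C) : content [c] = c.
Proof. apply tensor_unit_r. Qed.

Lemma content_app (C : SSMC) (a b : list (Ob C)) :
  content (a ++ b) = content a ⊗ content b.
Proof.
  induction a as [|x a IH]; simpl.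
  - symmetry. apply tensor_unit_l.
  - rewrite tensor_assoc. f_equal. exact IH.
Qed.

Definition Prop_cat (C : SSMC) : Category :=
  {| Ob := list (Ob C);
     Hom := fun a b => @Hom C (content a) (content b);
     idn := fun a => idn (content a);
     comp := fun a b c g f => g ∘ f;
     comp_id_l := fun a b f => comp_id_l f;
     comp_id_r := fun a b f => comp_id_r f;
     comp_assoc := fun a b c d h g f => comp_assoc h g f |}.

(* The tensor of arrows and the swaps of Prop(C) are those of C: the
   [eq_hom]s only retype them along {a + b} = {a} ⊗ {b}. *)
Definition Prop_tensor_hom (C : SSMC) (a b a' b' : list (Ob C))
    (f : @Hom C (content a) (content a')) (g : @Hom C (content b) (content b')) :
  @Hom C (content (a ++ b)) (content (a' ++ b')) :=
  eq_hom (eq_sym (content_app a' b')) ∘ (f ⊗₁ g) ∘ eq_hom (content_app a b).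

Definition Prop_swap (C : SSMC) (a b : list (Ob C)) :
  @Hom C (content (a ++ b)) (content (b ++ a)) :=
  eq_hom (eq_sym (content_app b a)) ∘ swap (content a) (content b)
    ∘ eq_hom (content_app a b).

Lemma heq_Prop_tensor_hom (C : SSMC) (a b a' b' : list (Ob C))
    (f : @Hom C (content a) (content a')) (g : @Hom C (content b) (content b')) :
  heq (Prop_tensor_hom f g) (f ⊗₁ g).
Proof.
  eapply heq_trans; [apply heq_eq_hom_r | apply heq_eq_hom_l].
Qed.

Lemma heq_Prop_swap (C : SSMC) (a b : list (Ob C)) :
  heq (Prop_swap a b) (swap (content a) (content b)).
Proof.
  eapply heq_trans; [apply heq_eq_hom_r | apply heq_eq_hom_l].
Qed.

Lemma Prop_eq_hom (C : SSMC) (a b : list (Ob C)) (e : a = b) :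
  @eq_hom (Prop_cat C) a b e = @eq_hom C _ _ (f_equal (@content C) e).
Proof. destruct e. reflexivity. Qed.

Lemma is_identity_Prop (C : SSMC) (a b : list (Ob C)) (e : a = b) :
  @is_identity C _ _ (@eq_hom (Prop_cat C) a b e).
Proof. rewrite Prop_eq_hom. apply is_identity_eq_hom. Qed.

Lemma is_identity_Prop_tensor (C : SSMC) (a b a' b' : list (Ob C))
    (f : @Hom C (content a) (content a')) (g : @Hom C (content b) (content b')) :
  @is_identity C _ _ f -> @is_identity C _ _ g ->
  @is_identity C _ _ (Prop_tensor_hom f g).
Proof.
  intros Hf Hg. unfold Prop_tensor_hom.
  apply is_identity_comp; [apply is_identity_comp |];
    try apply is_identity_eq_hom.
  destruct Hf, Hg. rewrite tensor_id. constructor.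
Qed.

Definition Prop_smc (C : SSMC) : SMC.
Proof.
  refine {| smc_cat := Prop_cat C;
            tensor := @app (Ob C);
            tensor_hom := @Prop_tensor_hom C;
            munit := @nil (Ob C);
            assoc := fun a b c =>
              @eq_hom (Prop_cat C) _ _ (eq_sym (app_assoc a b c));
            lunit := fun a => idn (content a);
            runit := fun a => @eq_hom (Prop_cat C) _ _ (app_nil_r a);
            swap := @Prop_swap C |}.
  - intros a b. apply (heq_eq (C := C)). simpl.
    eapply heq_trans; [apply heq_Prop_tensor_hom |]. rewrite tensor_id. apply heq_idn. now rewrite content_app.
  - intros. apply (heq_eq (C := C)). simpl.
    eapply heq_trans; [apply heq_Prop_tensor_hom |]. rewrite tensor_comp.
    apply heq_comp; apply heq_sym, heq_Prop_tensor_hom.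
  - intros. apply is_identity_iso, is_identity_eq_hom.
  - intros. apply (is_iso_idn (C := Prop_cat C)).
  - intros. apply is_identity_iso, is_identity_eq_hom.
  - intros. apply (heq_eq (C := C)). simpl.
    eapply heq_trans; [apply heq_identity_l, is_identity_Prop |].
    apply heq_sym.
    eapply heq_trans; [apply heq_identity_r, is_identity_Prop |].
    eapply heq_trans; [apply heq_Prop_tensor_hom |].
    eapply heq_trans;
      [apply heq_tensor; [constructor | apply heq_Prop_tensor_hom] |].
    apply heq_sym.
    eapply heq_trans; [apply heq_Prop_tensor_hom |].
    eapply heq_trans;
      [apply heq_tensor; [apply heq_Prop_tensor_hom | constructor] |].
    apply heq_tensor_assoc.
  - intros. apply (heq_eq (C := C)). simpl.
    rewrite comp_id_l, comp_id_r.
    eapply heq_trans;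
      [apply (@heq_Prop_tensor_hom C [] a [] a') | apply heq_tensor_unit_l].
  - intros. apply (heq_eq (C := C)). simpl.
    eapply heq_trans; [apply heq_identity_l, is_identity_Prop |].
    apply heq_sym.
    eapply heq_trans; [apply heq_identity_r, is_identity_Prop |].
    apply heq_sym.
    eapply heq_trans;
      [apply (@heq_Prop_tensor_hom C a [] a' []) | apply heq_tensor_unit_r].
  - intros. apply (heq_eq (C := C)). simpl.
    eapply heq_trans;
      [apply heq_comp; [apply heq_Prop_swap | apply heq_Prop_tensor_hom] |].
    rewrite swap_nat. apply heq_sym.
    apply heq_comp; [apply heq_Prop_tensor_hom | apply heq_Prop_swap].
  - intros. apply (is_identity_eq (C := C)); simpl;
      repeat first [apply is_identity_Prop_tensor | apply is_identity_Prop
                   | apply is_identity_idn | apply is_identity_comp].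
  - intros. apply (is_identity_eq (C := C)); simpl;
      repeat first [apply is_identity_Prop_tensor | apply is_identity_Prop
                   | apply is_identity_idn | apply is_identity_comp].
  - intros. apply (heq_eq (C := C)). simpl.
    eapply heq_trans; [apply heq_comp; apply heq_Prop_swap |].
    rewrite swap_swap. apply heq_idn. now rewrite content_app.
  - intros a b c. apply (heq_eq (C := C)). simpl.
    eapply heq_trans; [apply heq_identity_r, is_identity_Prop |].
    eapply heq_trans; [apply heq_identity_l, is_identity_Prop |].
    eapply heq_trans; [apply heq_Prop_swap |].
    eapply heq_trans;
      [apply heq_swap; [reflexivity | apply content_app] |].
    eapply heq_trans; [apply heq_hexagon |].
    rewrite <- comp_assoc.
    apply heq_comp.
    + eapply heq_trans;
        [| apply heq_sym, heq_Prop_tensor_hom].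
      apply heq_tensor; [constructor | apply heq_sym, heq_Prop_swap].
    + eapply heq_trans; [apply heq_eq_hom_l |].
      apply heq_sym.
      eapply heq_trans; [apply heq_identity_l, is_identity_Prop |].
      eapply heq_trans; [apply heq_Prop_tensor_hom |].
      apply heq_tensor; [apply heq_Prop_swap | constructor].
Defined.

Lemma Prop_strict (C : SSMC) : is_strict (Prop_smc C).
Proof.
  split; [| split]; intros.
  - apply is_identity_eq_hom.
  - apply (is_identity_idn (C := Prop_cat C)).
  - apply is_identity_eq_hom.
Qed.

Definition Prop_ssmc (C : SSMC) : SSMC :=
  {| ssmc_smc := Prop_smc C; ssmc_strict := Prop_strict C |}.

Lemma Prop_content_word (C : SSMC) (w : list (Ob C)) :
  @content (Prop_smc C) (map (fun c => [c]) w) = w.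
Proof.
  induction w as [|c w IH]; simpl; [reflexivity |].
  f_equal. exact IH.
Qed.

Definition Prop_of (C : SSMC) : prop.
Proof.
  refine {| prop_ssmc := Prop_ssmc C;
            colour := Ob C;
            colour_ob := fun c => [c] |}.
  intros x. exists x. split.
  - apply Prop_content_word.
  - intros w <-. apply Prop_content_word.
Defined.

(* Main.v *)
Require Import Defs.
From Stdlib Require Import List.
Import ListNotations.

(** An object of Prop(C) is a list, but its arrows see only the content of the
    list; so taking contents is a functor [content_smf] that is the identity
    on hom-sets, and its only structure is the reassociation
    {a + b} = {a} ⊗ {b}.  Conversely [singleton_smf] sends an object c to the
    one-element list [c].  As {[c]} = c ⊗ I, which equals c by strictness, the
    right unitor of C provides both comparison isomorphisms: from {[c]} to c
    in C, and from [{l}] to l in Prop(C), the latter being an arrow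
    {l} ⊗ I -> {l} of C.  Their naturality is that of the unitor.

    The coherence axioms hold because every structure arrow involved is an
    identity of C up to equality of its endpoints ([is_identity]), and two
    parallel arrows of this kind are equal ([is_identity_eq]).  This settles
    all axioms that speak of structure arrows alone; the remaining ones
    (naturality and compatibility with swaps) reduce, after erasing such
    identities by [heq], to equations between the same arrows of C. *)

Set Implicit Arguments.
Unset Strict Implicit.
Unset Printing Implicit Defensive.
Local Open Scope cat_scope.

Lemma is_identity_tensor (C : SMC) (a b a' b' : Ob C)
    (f : Hom a a') (g : Hom b b') :
  is_identity f -> is_identity g -> is_identity (f ⊗₁ g).
Proof. intros [] []. rewrite tensor_id. constructor. Qed.

Lemma is_identity_assoc (C : SSMC) (a b c : Ob C) : is_identity (assoc a b c).
Proof. apply (ssmc_strict C). Qed.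

Lemma is_identity_lunit (C : SSMC) (a : Ob C) : is_identity (lunit a).
Proof. apply (ssmc_strict C). Qed.

Lemma is_identity_runit (C : SSMC) (a : Ob C) : is_identity (runit a).
Proof. apply (ssmc_strict C). Qed.

(** For arrows composed and tensored from structure arrows of C and Prop(C). *)
Ltac structural :=
  repeat first
    [ apply is_identity_idn | apply is_identity_eq_hom
    (* The equality of lists is passed explicitly because its endpoints may be
       reduced, and then do not unify with the content of an unknown list. *)
    | match goal with
      | |- is_identity (@eq_hom (Prop_cat ?C) _ _ ?e) =>
          exact (is_identity_Prop (C := C) e)
      end
    | apply is_identity_assoc | apply is_identity_lunit
    | apply is_identity_runit | apply is_identity_comp
    | apply is_identity_tensor | apply is_identity_Prop_tensor ].

Definition content_functor (C : SSMC) : Functor (Prop_smc C) C :=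
  {| fob := (@content C : Ob (Prop_smc C) -> Ob C);
     fhom := fun a b f => f;
     fhom_id := fun a => eq_refl;
     fhom_comp := fun a b c g f => eq_refl |}.

Definition content_smf (C : SSMC) : SMFunctor (Prop_smc C) C.
Proof.
  refine {| smf_functor := content_functor C;
            phi := fun a b => eq_hom (content_app a b);
            phi_unit := idn munit |}; simpl; intros.
  - apply is_identity_iso; structural.
  - apply is_iso_idn.
  - apply heq_eq.
    eapply heq_trans; [apply heq_eq_hom_l |].
    eapply heq_trans; [apply heq_Prop_tensor_hom |].
    apply heq_sym, heq_eq_hom_r.
  - apply is_identity_eq; structural.
  - apply is_identity_eq; structural.
  - apply is_identity_eq; structural.
  - apply heq_eq.
    eapply heq_trans; [apply heq_eq_hom_r |].
    apply heq_sym.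
    eapply heq_trans; [apply heq_eq_hom_l | apply heq_Prop_swap].
Defined.

(** Since {[c]} is c ⊗ I rather than c on the nose, f acts on one-element
    lists as f ⊗ id. *)
Definition singleton_functor (C : SSMC) : Functor C (Prop_smc C).
Proof.
  refine {| fob := fun c : Ob C => ([c] : Ob (Prop_smc C));
            fhom := fun a b f => f ⊗₁ idn munit |}.
  - intros. apply tensor_id.
  - intros. apply tensor_comp_l.
Defined.

Definition singleton_smf (C : SSMC) : SMFunctor C (Prop_smc C).
Proof.
  (* On contents the comparison arrows run (a ⊗ b) ⊗ I -> a ⊗ (b ⊗ I) and
     I ⊗ I -> I, so an associator and a left unitor of C have the right type. *)
  refine {| smf_functor := singleton_functor C;
            phi := fun a b => (assoc a b munit : @Hom (Prop_smc C) [a ⊗ b] [a; b]);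
            phi_unit := (lunit munit : @Hom (Prop_smc C) [munit] []) |};
    simpl; intros.
  - exact (assoc_iso a b munit).
  - exact (lunit_iso (munit : Ob C)).
  - apply (heq_eq (C := C)).
    eapply heq_trans; [apply heq_identity_l; structural |].
    eapply heq_trans; [apply heq_tensor_unit_r |].
    apply heq_sym.
    eapply heq_trans; [apply heq_identity_r; structural |].
    eapply heq_trans; [apply (@heq_Prop_tensor_hom C [a] [b] [a'] [b']) |].
    apply heq_tensor; apply heq_tensor_unit_r.
  - apply (is_identity_eq (C := C)); structural.
  - apply (is_identity_eq (C := C)); structural.
  - apply (is_identity_eq (C := C)); structural.
  - apply (heq_eq (C := C)).
    eapply heq_trans; [apply heq_identity_r; structural |].
    eapply heq_trans; [apply (@heq_Prop_swap C [a] [b]) |].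
    eapply heq_trans; [apply heq_swap; apply content_single |].
    apply heq_sym.
    eapply heq_trans; [apply heq_identity_l; structural |].
    apply heq_tensor_unit_r.
Defined.

Definition content_singleton (C : SSMC) :
  NatTrans (comp_smf (content_smf C) (singleton_smf C)) (id_smf C) :=
  @Build_NatTrans C C
    (comp_smf (content_smf C) (singleton_smf C)) (id_smf C)
    (fun c => runit c) (fun a b f => runit_nat f).

Definition singleton_content (C : SSMC) :
  NatTrans (comp_smf (singleton_smf C) (content_smf C)) (id_smf (Prop_smc C)) :=
  @Build_NatTrans (Prop_smc C) (Prop_smc C)
    (comp_smf (singleton_smf C) (content_smf C)) (id_smf (Prop_smc C))
    (fun l => runit (content l)) (fun a b f => @runit_nat C _ _ f).

Lemma content_singleton_monoidal (C : SSMC) : is_monoidal (content_singleton C).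
Proof.
  split; simpl; intros; apply is_identity_eq; structural.
Qed.

Lemma singleton_content_monoidal (C : SSMC) : is_monoidal (singleton_content C).
Proof.
  split; simpl; intros; apply (is_identity_eq (C := C)); structural.
Qed.

Theorem theorem2 (C : SSMC) :
  monoidally_equivalent (prop_ssmc (Prop_of C)) C.
Proof.
  exists (content_smf C), (singleton_smf C),
    (content_singleton C), (singleton_content C).
  split; split.
  - intros c. exact (runit_iso c).
  - apply content_singleton_monoidal.
  - intros l. exact (runit_iso (content l)).
  - apply singleton_content_monoidal.
Qed.
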